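(* Let $\alpha=(\alpha_1,\dots,\alpha_m)$ be a strong composition of $n\ge1$ and $\delta=(\delta_1,\dots,\delta_m)$ a weak composition of $k$ with $\delta_1=0$. Set $n_\ell=\alpha_1+\cdots+\alpha_\ell$, $k_\ell=\delta_1+\cdots+\delta_\ell$, and $d=\gcd(n,k)$. Then, modulo $q^n-1$ (in $\mathbb{Q}[q,q^{-1}]$), $$\mathcal{W}^{\mathrm{maj}}_{\alpha,\delta}(q)\equiv\frac{d}{\alpha_1}\left(\frac{q^n-1}{q^d-1}\right)\prod_{\ell=2}^mq^{k_\ell\alpha_\ell}\binom{n_{\ell-1}-k_{\ell-1}}{\delta_\ell}_q\left(\!\!\binom{k_\ell}{\alpha_\ell-\delta_\ell}\!\!\right)_{q^{-1}}$$ $$\equiv\frac{d}{\alpha_1}\left(\frac{q^n-1}{q^d-1}\right)q^{\binom k2+\sum_{\ell=2}^m\binom{\delta_\ell}{2}-\alpha_1}\prod_{\ell=2}^m\binom{n_{\ell-1}-k_{\ell-1}}{\delta_\ell}_q\left(\!\!\binom{k_\ell}{\alpha_\ell-\delta_\ell}\!\!\right)_q.$$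
   Context: A word of length $n$ is a sequence $w=w_1\cdots w_n$ of positive integers; its content is the sequence whose $j$-th entry is the number of $j$'s. $\mathrm{maj}(w)=\sum_{1\le i<n,\,w_i>w_{i+1}}i$. $\mathrm{cdes}(w)=\#\{1\le i\le n:w_i>w_{i+1}\}$ with indices mod $n$ (empty word: 0). $w^{(i)}$ is the subsequence of letters $\le i$. For $w$ of content $\alpha$ with $m$ parts, $\mathrm{CDT}(w)=(\mathrm{cdes}(w^{(1)}),\mathrm{cdes}(w^{(2)})-\mathrm{cdes}(w^{(1)}),\dots,\mathrm{cdes}(w^{(m)})-\mathrm{cdes}(w^{(m-1)}))$. $\mathcal{W}_{\alpha,\delta}$ is the set of words with content $\alpha$ and $\mathrm{CDT}=\delta$, and $\mathcal{W}^{\mathrm{maj}}_{\alpha,\delta}(q)=\sum_{w\in\mathcal{W}_{\alpha,\delta}}q^{\mathrm{maj}(w)}$. $\binom{a}{b}_q$ is the Gaussian binomial coefficient for $0\le b\le a$ and $0$ otherwise; $\left(\!\binom{N}{j}\!\right)_q=h_j(1,q,\dots,q^{N-1})$, which equals $\binom{N+j-1}{j}_q$ for $N\ge1$, $1$ for $N=j=0$, and $0$ for $N=0<j$. The subscript $q^{-1}$ means substituting $q^{-1}$ for $q$. *)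

(* Defs.v *)
From mathcomp Require Import all_boot all_order all_algebra.

Set Implicit Arguments.
Unset Strict Implicit.
Unset Printing Implicit Defensive.

Import GRing.Theory.
Local Open Scope ring_scope.

(* Compositions are [seq nat]; [part] and [psum] use 1-based indices:
   [part a l] is a_l (for l >= 1) and [psum a l] is a_1 + ... + a_l. *)
Definition part (a : seq nat) (l : nat) : nat := nth 0%N a l.-1.

Definition psum (a : seq nat) (l : nat) : nat := sumn (take l a).

Definition weak_composition (k : nat) (a : seq nat) : bool := sumn a == k.

Definition strong_composition (n : nat) (a : seq nat) : bool :=
  all (fun x => 0 < x)%N a && weak_composition n a.

(* Words are [seq nat]; [nth 0 w i.-1] is the i-th letter w_i. *)
Definition maj (w : seq nat) : nat :=
  (\sum_(1 <= i < size w | nth 0 w i < nth 0 w i.-1) i)%N.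

Definition cdes (w : seq nat) : nat :=
  #|[set i : 'I_(size w) | nth 0 w (i.+1 %% size w) < nth 0 w i]|%N.

(* the subsequence w^(i) of letters at most i *)
Definition restrict (i : nat) (w : seq nat) : seq nat :=
  [seq x <- w | x <= i]%N.

(* the first m entries of the content of w *)
Definition content (m : nat) (w : seq nat) : seq nat :=
  [seq count_mem j w | j <- iota 1 m].

(* The entry at l = 1 is cdes(w^(1)) itself: words have positive letters, so
   w^(0) is empty and cdes(w^(0)) = 0. *)
Definition CDT (m : nat) (w : seq nat) : seq int :=
  [seq (cdes (restrict l w))%:Z - (cdes (restrict l.-1 w))%:Z | l <- iota 1 m].

(* The ordinal i : 'I_m encodes the letter i + 1, so that letters are the
   integers 1, ..., m. *)
Definition letters (m n : nat) (w : n.-tuple 'I_m) : seq nat :=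
  [seq (nat_of_ord i).+1 | i <- w].

(* A word of content alpha has length sumn alpha and letters among
   1, ..., size alpha. *)
Definition words (alpha delta : seq nat) :
    {set (sumn alpha).-tuple 'I_(size alpha)} :=
  [set w : (sumn alpha).-tuple 'I_(size alpha) |
    (content (size alpha) (letters w) == alpha) &&
    (CDT (size alpha) (letters w) == [seq d%:Z | d <- delta])].

Definition words_maj (R : nzRingType) (q : R) (alpha delta : seq nat) : R :=
  \sum_(w in words alpha delta) q ^+ maj (letters w).

(* [a]_q! = (1)(1 + q) ... (1 + q + ... + q^(a-1)) *)
Definition qfact (F : fieldType) (q : F) (a : nat) : F :=
  \prod_(1 <= i < a.+1) \sum_(0 <= j < i) q ^+ j.

(* The value at q of the Gaussian binomial coefficient, provided that the
   q-factorials below do not vanish (e.g., q transcendental over rat). *)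
Definition qbinom (F : fieldType) (q : F) (a b : int) : F :=
  if (0 <= b) && (b <= a) then
    qfact q `|a|%N / (qfact q `|b|%N * qfact q `|a - b|%N)
  else 0.

(* The complete homogeneous symmetric polynomial h_j in the N values x_i: its
   monomials are indexed by weakly increasing sequences of j indices. *)
Definition complete_hom (R : comNzRingType) (N j : nat) (x : 'I_N -> R) : R :=
  \sum_(t : j.-tuple 'I_N | sorted leq (map val t)) \prod_(i <- t) x i.

(* h_j(1, q, ..., q^(N-1)), with the convention h_j = 0 for j < 0 *)
Definition qmultichoose (R : comNzRingType) (q : R) (N : nat) (j : int) : R :=
  if j is Posz j' then complete_hom j' (fun i : 'I_N => q ^+ i) else 0.

(* The ring Q[q, q^-1] is realised as a subring of the field Q(q). *)
Definition Qq : fieldType := {fraction {poly rat}}.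

Definition q : Qq := tofrac 'X.

Definition laurent (x : Qq) : Prop :=
  exists (p : {poly rat}) (N : nat), x = tofrac p * q ^- N.

(* congruence modulo the ideal of Q[q, q^-1] generated by q^n - 1 *)
Definition laurent_congr (n : nat) (x y : Qq) : Prop :=
  [/\ laurent x, laurent y & exists2 z, laurent z & x - y = (q ^+ n - 1) * z].

(* Main.v *)
Require Import Defs.
From mathcomp Require Import all_boot all_order all_algebra.
From mathcomp Require Import zify ring.

(* Modulo n, maj w is the sum of the cyclic descent positions of w, so a rotation
   by one position changes it by the number k of cyclic descents.  Moving each
   letter 1 in turn to the front therefore gives, modulo q^n - 1,
     alpha_1 W(q) = (sum_(i < n) q^((i+1) k)) G(q),
   where G is the generating function of the (0-based) sum of the cyclic descent
   positions over the words that begin with 1; the first factor is congruent to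
   d (q^n - 1) / (q^d - 1).  The product formula for G is exact.  Such words arise
   by inserting the letters 2, 3, ... in turn: copies of l create a new cyclic
   descent exactly when they follow a letter that is not a cyclic descent, and
   then the remaining copies are distributed freely over the k_l descents. *)

Set Implicit Arguments.
Unset Strict Implicit.
Unset Printing Implicit Defensive.

Import GRing.Theory.
Local Open Scope ring_scope.

(** * Insertion of a new largest letter *)

(* Descents of [u] followed by the letter [t]; [lmaj] adds up their positions,
   counted from 0. *)
Fixpoint ldes (t : nat) (u : seq nat) : nat :=
  if u is a :: u' then ((head t u' < a) + ldes t u')%N else 0%N.

Fixpoint lmaj (t : nat) (u : seq nat) : nat :=
  if u is _ :: u' then (ldes t u' + lmaj t u')%N else 0%N.

Lemma ldes_size t u : (ldes t u <= size u)%N.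
Proof. by elim: u => //= a u IH; case: (_ < _)%N => /=; lia. Qed.

Lemma ldes_sum t u :
  ldes t u = (\sum_(i < size u) (nth t u i.+1 < nth t u i)%N)%N.
Proof.
elim: u => [|a u IH]; first by rewrite big_ord0.
by rewrite big_ord_recl /= nth0 IH.
Qed.

Lemma lmaj_sum t u :
  lmaj t u = (\sum_(i < size u) i * (nth t u i.+1 < nth t u i)%N)%N.
Proof.
elim: u => [|a u IH]; first by rewrite big_ord0.
rewrite big_ord_recl /= mul0n add0n IH ldes_sum -big_split /=.
by apply: eq_bigr => i _; rewrite mulSn.
Qed.

(** The last copy of [l] descends to the head of [u], while [b] and the other copies do not descend.
    A nonempty run thus yields one descent, whether or not [b] was one. *)
Lemma ldes_block t b c l u : (head t u < l)%N -> (b < l)%N ->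
  ldes t (b :: nseq c l ++ u) =
  (ldes t u + (if c == 0 then head t u < b else true)%N)%N.
Proof.
move=> hu hb; case: c => [|c]; first by rewrite /= addnC.
rewrite /=.
have -> : (l < b)%N = false by lia.
rewrite add0n; elim: c => [|c IH] /=; first by rewrite hu addnC.
by rewrite ltnn add0n.
Qed.

(** The descents of [u] move by [c + 1], and the end of the run is a descent at position [c]. For
    [c = 0] a descent at [b] has position 0, so no case distinction arises. *)
Lemma lmaj_block t b c l u : (head t u < l)%N ->
  lmaj t (b :: nseq c l ++ u) =
  (lmaj t u + ldes t u + c * (ldes t u).+1)%N.
Proof.
move=> hu.
have Hd j : ldes t (nseq j.+1 l ++ u) = (ldes t u).+1.
  elim: j => [|j IH] /=; first by rewrite hu.
  by rewrite ltnn add0n.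
have lmajE a w : lmaj t (a :: w) = (ldes t w + lmaj t w)%N by [].
elim: c b => [|c IH] b; first by rewrite lmajE /= addnC mul0n addn0.
by rewrite lmajE Hd [nseq _ _ ++ _]/= IH; lia.
Qed.

(* The letter [l] is never inserted at the front of [v]. *)
Fixpoint insertions (l a : nat) (v : seq nat) : seq (seq nat) :=
  if v is b :: v' then
    [seq b :: nseq c l ++ u | c <- iota 0 a.+1, u <- insertions l (a - c) v']
  else if a == 0 then [:: [::]] else [::].

Lemma mem_insertions (l a : nat) (v u : seq nat) : all (predC1 l) v ->
  (u \in insertions l a v) =
  [&& head l.+1 u != l, count_mem l u == a & [seq x <- u | x != l] == v].
Proof.
elim: v a u => [|b v IH] a u.
  move=> _ /=; have -> : (u \in (if a == 0 then [:: [::]] else [::])) =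
    (a == 0) && (u == [::]).
    by case: eqP => _; rewrite ?inE.
  case: u => [|x u] /=; first by rewrite andbT eqxx neq_ltn ltnSn orbT eq_sym andbT.
  by rewrite andbF; case: (x =P l) => //=; rewrite andbF.
move=> /andP[hb0 hv]; have {hb0} hb : b != l := hb0.
apply/allpairsPdep/idP => [[c [u' [hc hu' ->]]]|].
  move: hu'; rewrite IH // => /and3P[h1 h2 h3].
  rewrite mem_iota in hc.
  rewrite /= hb (negbTE hb) /= count_cat count_nseq /= eqxx mul1n (eqP h2).
  rewrite filter_cat (eqP h3) /=.
  have -> : [seq x <- nseq c l | x != l] = [::].
    by apply/eqP; rewrite -size_eq0 size_filter count_nseq /= eqxx.
  by rewrite eqxx andbT; apply/eqP; lia.
case: u => [|x u]; first by case/and3P.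
case/and3P=> /= xl; rewrite (negbTE xl) /=.
(* The maximal run of [l] after the first letter is split off. The default [l.+1] lets an empty
   remainder count as not beginning with [l]. *)
have : {c & {u' | u = nseq c l ++ u' & head l.+1 u' != l}}.
  elim: u => [|y u [c [u' -> hu']]].
    by exists 0, [::] => //=; rewrite neq_ltn ltnSn orbT.
  case: (y =P l) => [->|/eqP yl]; first by exists c.+1, u'.
  by exists 0, (y :: nseq c l ++ u').
move=> [c [u' -> hu']].
rewrite count_cat count_nseq /= eqxx mul1n filter_cat.
have -> : [seq x <- nseq c l | x != l] = [::].
  by apply/eqP; rewrite -size_eq0 size_filter count_nseq /= eqxx.
rewrite add0n => /eqP ha /eqP [<- hu].
exists c, u'; split; [by rewrite -/(iota 0 a.+1) mem_iota; lia| |by []].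
by rewrite IH // hu' hu eqxx andbT -ha addKn eqxx.
Qed.

(** The run length can be read off the result, because the remainder never begins with [l]. *)
Lemma uniq_insertions l a v : all (predC1 l) v -> uniq (insertions l a v).
Proof.
elim: v a => [|b v IH] a; first by rewrite /=; case: (a == 0).
case/andP=> hb hv; apply: allpairs_uniq_dep.
- exact: iota_uniq.
- by move=> c _; apply: IH.
move=> _ _ /allpairsPdep[c [u [hc hu ->]]] /allpairsPdep[c' [u' [hc' hu' ->]]].
move=> /= [].
move: hu hu'; rewrite !mem_insertions // => /and3P[hu _ _] /and3P[hu' _ _].
have : c = c' -> nseq c l ++ u = nseq c' l ++ u' ->
  existT (fun=> seq nat) c u = existT _ c' u'.
  by move=> <- /eqP; rewrite eqseq_cat // => /andP[_ /eqP->].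
move=> H E; apply: (H _ E) => {H}.
elim: c c' E {hc hc'} => [|c IHc] [|c'] //= E.
- by move: hu; rewrite E /= eqxx.
- by move: hu'; rewrite -E /= eqxx.
- by case: E => /IHc->.
Qed.

Lemma insertions_head l a v u t : all (predC1 l) v -> u \in insertions l a v ->
  head t u = head t v.
Proof.
case: v => [|b v].
  by rewrite /=; case: (a == 0) => //; rewrite inE => _ /eqP->.
by move=> _ /allpairsPdep[c [u' [_ _ ->]]].
Qed.

Lemma insertions_ldes l a v u t : (t < l)%N -> all (gtn l) v ->
  u \in insertions l a v ->
  (ldes t v <= ldes t u)%N.
Proof.
move=> tl; elim: v a u => [|b v IH] a u // /andP[hb hv].
move=> /allpairsPdep[c [u' [_ hu' ->]]].
have hv' : all (predC1 l) v.
  by apply: sub_all hv => x /=; rewrite ltn_neqAle => /andP[].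
have hh := insertions_head t hv' hu'.
have hl : (head t v < l)%N by case: v {IH hh hu' hv'} hv => [|x v] //= /andP[].
rewrite ldes_block ?hh // addnC; apply: leq_add; last exact: IH hv hu'.
by case: eqP => // _; case: (_ < _)%N.
Qed.

(** * Division-free q-analogues and the generating function of one insertion step *)

Section qAnalogues.
Variables (R : comNzRingType) (z : R).

(** The Gaussian binomial by the q-Pascal rule, in the form produced by inserting a run after a
    letter that is not a descent. *)
Fixpoint gauss (n k : nat) : R :=
  match n, k with
  | _, 0 => 1
  | 0, _.+1 => 0
  | n'.+1, k'.+1 => z ^+ k * gauss n' k + gauss n' k'
  end.

(* [hq e j] is h_j(z, z^2, ..., z^e) *)
Fixpoint hq (e j : nat) : R :=
  if e is e'.+1 then \sum_(c < j.+1) z ^+ (e * c) * hq e' (j - c)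
  else (j == 0)%:R.

Definition hsub (e a b : nat) : R := if (b <= a)%N then hq e (a - b) else 0.

Lemma gauss0 n : gauss n 0 = 1. Proof. by case: n. Qed.

Lemma hqS e j : hq e.+1 j.+1 = hq e j.+1 + z ^+ e.+1 * hq e.+1 j.
Proof.
rewrite [LHS]/= big_ord_recl muln0 expr0 mul1r subn0; congr (_ + _).
rewrite [in RHS]/= mulr_sumr; apply: eq_bigr => i _ /=.
by rewrite subSS mulrA -exprD; congr (_ ^+ _ * _); rewrite /bump /=; lia.
Qed.

Lemma hsubS e a b :
  hsub e.+1 a b = \sum_(c < a.+1) z ^+ (e.+1 * c) * hsub e (a - c) b.
Proof.
rewrite /hsub; case: leqP => h; last first.
  rewrite big1 // => c _; case: leqP => [|_]; last by rewrite mulr0.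
  by have := leq_subr c a; lia.
rewrite /= (big_ord_widen a.+1 (fun c => z ^+ (e.+1 * c) * hq e (a - b - c))).
  2: lia.
rewrite big_mkcond; apply: eq_bigr => c _.
have -> : (b <= a - c)%N = (c < (a - b).+1)%N by have := ltn_ord c; lia.
by case: ifP => _; rewrite ?mulr0 // subnAC.
Qed.

Lemma hsubSS e a b : hsub e a.+1 b.+1 = hsub e a b.
Proof. by rewrite /hsub ltnS subSS. Qed.

(* Each copy of [l] in the run after the r-th descent from the right moves r
   descents, hence the variables z, ..., z^e of [hq]. *)
Lemma insertions_gf t l a v k : (t < l)%N -> all (gtn l) v ->
  \sum_(u <- insertions l a v | ldes t u == (ldes t v + k)%N) z ^+ lmaj t u =
  z ^+ (lmaj t v + (ldes t v + k) * k) * gauss (size v - ldes t v) k *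
  hsub (ldes t v + k) a k.
Proof.
move=> tl; elim: v a k => [|b v IH] a k.
  move=> _ /=; case: a => [|a] /=; last first.
    rewrite big_nil; case: k => [|k]; first by rewrite /hsub /= mulr0.
    by rewrite /= ?(mulr0, mul0r).
  rewrite big_cons big_nil /= /hsub.
  case: k => [|k] /=; last by rewrite /= ?(mulr0, mul0r).
  by rewrite !mulr1 addr0.
move=> /andP[hb hv].
have hv' : all (predC1 l) v.
  by apply: sub_all hv => x /=; rewrite ltn_neqAle => /andP[].
have hl : (head t v < l)%N by case: v {IH hv'} hv => [|x v] //= /andP[].
pose K := ldes t v.
pose S c e := \sum_(u <- insertions l (a - c) v | ldes t u == e) z ^+ lmaj t u.
have HS c e : \sum_(u <- insertions l (a - c) v | ldes t u == e)
    z ^+ (lmaj t u + ldes t u + c * (ldes t u).+1)%N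
    = z ^+ (e + c * e.+1) * S c e.
  rewrite /S mulr_sumr; apply: eq_bigr => u /eqP ->.
  by rewrite -exprD; congr (_ ^+ _); lia.
pose w c u := b :: nseq c l ++ u.
(* Since [u] and [v] have the same head, the descent at the end of the run, or at [b] if the run is
   empty, depends only on [c]. *)
have HB c e (d : bool) : (if c == 0 then (head t v < b)%N else true) = d ->
    \sum_(u <- insertions l (a - c) v | ldes t (w c u) == (e + d)%N)
      z ^+ lmaj t (w c u) = z ^+ (e + c * e.+1) * S c e.
  move=> hd; rewrite -HS big_seq_cond [RHS]big_seq_cond.
  have hh u : u \in insertions l (a - c) v -> (head t u < l)%N.
    by move=> /(insertions_head t hv') ->.
  apply: eq_big => [u|u /andP[hu _]]; last by rewrite lmaj_block // hh.
  case hu : (u \in _); rewrite ?andFb // !andTb.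
  by rewrite /w ldes_block ?hh // (insertions_head t hv' hu) hd eqn_add2r.
have insertionsE : insertions l a (b :: v) =
  [seq w c u | c <- index_iota 0 a.+1, u <- insertions l (a - c) v].
  by rewrite /index_iota subn0.
have ldesE : ldes t (b :: v) = ((head t v < b) + K)%N by [].
have lmajE : lmaj t (b :: v) = (K + lmaj t v)%N by [].
have HK : (K <= size v)%N := ldes_size t v.
have szE : size (b :: v) = (size v).+1 by [].
have IHk c j : S c (K + j)%N = _ := IH (a - c)%N j hv.
have -> : \sum_(u <- insertions l a (b :: v) | ldes t u == (ldes t (b :: v) + k)%N)
      z ^+ lmaj t u = \sum_(c < a.+1) \sum_(u <- insertions l (a - c) v |
        ldes t (w c u) == ((head t v < b) + K + k)%N) z ^+ lmaj t (w c u).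
  rewrite insertionsE big_mkcond big_allpairs_dep big_mkord.
  by apply: eq_bigr => c _; rewrite -big_mkcond.
rewrite ldesE lmajE szE {insertionsE ldesE lmajE szE}.
(* If [b] is already a descent, runs of every length keep the count, and the sum over [c] is the
   expansion [hsubS]. *)
case: ltnP => hbv.
  transitivity (\sum_(c < a.+1) z ^+ (K + k + c * (K + k).+1) * S c (K + k)%N).
    apply: eq_bigr => c _; rewrite -(HB _ _ true); last by case: eqP.
    by apply: eq_bigl => u; congr (_ == _); rewrite /=; lia.
  under eq_bigr => c _ do rewrite IHk.
  rewrite !add1n addSn subSS hsubS mulr_sumr; apply: eq_bigr => c _ /=.
  rewrite -/K !mulrA -!exprD [_ * gauss _ _ * _ ^+ _]mulrAC -exprD.
  by congr (_ ^+ _ * _ * _); lia.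
(* If [b] is not a descent, only a nonempty run creates one; [c = 0] and [c > 0] give the two terms
   of the q-Pascal rule. *)
rewrite add0n big_ord_recl; have := HB 0 (K + k)%N false.
rewrite addn0 ltnNge hbv => -> //; rewrite IHk.
case: k => [|k].
  rewrite big1 ?addr0 => [|c _].
    rewrite !gauss0 !mulr1 mulrA -exprD.
    rewrite subn0; by congr (_ ^+ _ * _); rewrite -/K; lia.
  (* For [k = 0] no new descent is allowed, but a nonempty run creates one and insertion never
     lowers [ldes]. *)
  rewrite big_seq_cond big1 // => u /andP[hu].
  rewrite /w ldes_block //; last by rewrite (insertions_head t hv' hu).
  by have := insertions_ldes tl hv hu; rewrite -/K /=; lia.
have -> : \sum_(c < a) \sum_(u <- insertions l (a - lift ord0 c) v
      | ldes t (w (lift ord0 c) u) == (K + k.+1)%N)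
      z ^+ lmaj t (w (lift ord0 c) u) =
    \sum_(c < a) z ^+ (K + k + c.+1 * (K + k).+1) * S c.+1 (K + k)%N.
  apply: eq_bigr => c _; rewrite -(HB _ _ true) //.
  by apply: eq_bigl => u; congr (_ == _); rewrite /=; lia.
under eq_bigr => c _ do rewrite IHk.
rewrite -/K subn0 subSn // [gauss _ _]/= !(mulrDr, mulrDl); congr (_ + _).
  by rewrite !mulrA -!exprD; congr (_ ^+ _ * _ * _); lia.
rewrite addnS.
case: a {IH IHk S HS HB} => [|a]; first by rewrite big_ord0 /hsub ltn0 mulr0.
rewrite hsubSS hsubS mulr_sumr; apply: eq_bigr => c _ /=.
rewrite subSS !mulrA -!exprD [_ * gauss _ _ * _ ^+ _]mulrAC -exprD.
by congr (_ ^+ _ * _ * _); lia.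
Qed.

End qAnalogues.

(** * Rotations *)

Definition cyc_des (w : seq nat) (i : nat) : bool :=
  (nth 0 w (i.+1 %% size w) < nth 0 w i)%N.

Definition cmaj (w : seq nat) : nat := (\sum_(i < size w) i * cyc_des w i)%N.

Lemma cdes_sum w : cdes w = (\sum_(i < size w) cyc_des w i)%N.
Proof.
rewrite /cdes -sum1_card big_mkcond; apply: eq_bigr => i _.
by rewrite inE -/(cyc_des w i); case: (cyc_des w i).
Qed.

(** The cyclic successor of the last letter is the first letter [t], which the default value of
    [nth] supplies. *)
Lemma cyc_des_nth t u i : (i < (size u).+1)%N ->
  cyc_des (t :: u) i = (nth t (t :: u) i.+1 < nth t (t :: u) i)%N.
Proof.
move=> hi; rewrite /cyc_des; congr (_ < _)%N; last exact: set_nth_default.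
rewrite [size _]/=; have [->|ne] := eqVneq i (size u).
  by rewrite modnn [RHS]nth_default.
rewrite modn_small; last lia.
by apply: set_nth_default => /=; lia.
Qed.

Lemma cdes_ldes t u : cdes (t :: u) = ldes t (t :: u).
Proof.
rewrite cdes_sum ldes_sum; apply: eq_bigr => i _.
by rewrite cyc_des_nth.
Qed.

Lemma cmaj_lmaj t u : cmaj (t :: u) = lmaj t (t :: u).
Proof.
rewrite /cmaj lmaj_sum; apply: eq_bigr => i _.
by rewrite cyc_des_nth.
Qed.

(** Counting positions from 1 instead of 0 adds one per cyclic descent. A descent at the last
    position, which [maj] omits, then contributes [size w]. *)
Lemma maj_mod w : maj w = cmaj w + cdes w %[mod size w].
Proof.
rewrite /cmaj cdes_sum -big_split /= /maj.
case hs : (size w) => [|N]; first by rewrite big_ord0 big_geq.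
rewrite big_add1 big_mkord big_ord_recr /= -mulSnr [(N.+1 * _)%N]mulnC addnC modnMDl.
congr (_ %% _)%N; rewrite big_mkcond /=; apply: eq_bigr => i _.
rewrite -mulSnr /cyc_des hs modn_small ?ltnS //.
by case: ifP; rewrite (muln1, muln0).
Qed.

Lemma sum_ord_shift (i n : nat) (g : nat -> nat) :
  (\sum_(j < n) g ((i + j) %% n) = \sum_(j < n) g j)%N.
Proof.
case: n => [|n]; first by rewrite !big_ord0.
rewrite [RHS](reindex_inj (addrI (inZp i))) /=.
by apply: eq_bigr => j _; rewrite modnDml.
Qed.

Lemma nth_rot i j (w : seq nat) : (i <= size w)%N -> (j < size w)%N ->
  nth 0%N (rot i w) j = nth 0%N w ((i + j) %% size w).
Proof.
move=> hi hj; rewrite /rot nth_cat size_drop nth_drop.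
case: ltnP => h; first by rewrite modn_small //; lia.
rewrite nth_take; last lia.
have -> : (i + j = (j - (size w - i)) + size w)%N by lia.
by rewrite modnDr modn_small //; lia.
Qed.

Lemma cyc_des_rot i j w : (i <= size w)%N -> (j < size w)%N ->
  cyc_des (rot i w) j = cyc_des w ((i + j) %% size w).
Proof.
move=> hi hj; rewrite /cyc_des size_rot !nth_rot //; last first.
  by rewrite ltn_mod; lia.
by rewrite modnDmr addnS -[((_ %% _).+1)%N]addn1 modnDml addn1.
Qed.

Lemma cdes_rot i w : cdes (rot i w) = cdes w.
Proof.
case: (leqP i (size w)) => hi; last by rewrite rot_oversize // ltnW.
rewrite !cdes_sum size_rot -[RHS](sum_ord_shift i (size w) (cyc_des w)).
by apply: eq_bigr => j _; rewrite cyc_des_rot.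
Qed.

(** A cyclic descent at [j] in [rot i w] comes from position [i + j] of [w], modulo the size, so
    each of them moves by [i]. *)
Lemma cmaj_rot i w : (i <= size w)%N ->
  cmaj w = cmaj (rot i w) + i * cdes w %[mod size w].
Proof.
move=> hi; rewrite -(cdes_rot i) cdes_sum /cmaj size_rot.
rewrite -(sum_ord_shift i (size w) (fun j => j * cyc_des w j)%N) big_distrr.
rewrite -big_split /= -modn_summ -[RHS]modn_summ; congr (_ %% _)%N.
apply: eq_bigr => j _; rewrite cyc_des_rot // -mulnDl addnC.
by rewrite modnMml.
Qed.

(** * Words of given content and cyclic descent type *)

Lemma psumS a l : psum a l.+1 = (psum a l + part a l.+1)%N.
Proof.
rewrite /psum /part /=; elim: a l => [|x a IH] l; first by rewrite nth_nil.
case: l => [|l] /=; first by rewrite take0 addnC.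
by rewrite IH addnA.
Qed.

Lemma psum_size a : psum a (size a) = sumn a.
Proof. by rewrite /psum take_size. Qed.

(** Prescribing partial sums instead of the differences in [CDT] makes the condition for one more
    letter a mere conjunction. *)
Definition has_type (alpha delta : seq nat) (m : nat) (w : seq nat) : bool :=
  [&& all (fun x => 0 < x <= m)%N w,
      all (fun l => count_mem l w == part alpha l) (iota 1 m) &
      all (fun l => cdes (restrict l w) == psum delta l) (iota 1 m)].

Lemma restrict0 w : all (fun x => 0 < x)%N w -> restrict 0 w = [::].
Proof.
move=> h; apply/eqP; rewrite -size_eq0 size_filter; apply/eqP.
by elim: w h => //= x w IH /andP[hx /IH->]; case: x hx.
Qed.

Lemma restrict_id m w : all (fun x => 0 < x <= m)%N w -> restrict m w = w.
Proof.
by move=> h; apply/all_filterP; apply: sub_all h => x /andP[].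
Qed.

Lemma cdes_nil : cdes [::] = 0%N.
Proof. by rewrite cdes_sum big_ord0. Qed.

Lemma contentP (alpha w : seq nat) :
  (content (size alpha) w == alpha) =
  all (fun l => count_mem l w == part alpha l) (iota 1 (size alpha)).
Proof.
have sz : size (content (size alpha) w) = size alpha.
  by rewrite size_map size_iota.
apply/eqP/allP => [h l|h].
  rewrite mem_iota => hl; rewrite /part -[X in nth _ X]h.
  rewrite (nth_map 0%N) ?size_iota; last lia.
  by rewrite nth_iota; [apply/eqP; congr (count_mem _ w); lia|lia].
apply: (@eq_from_nth _ 0%N) => // i; rewrite sz => hi.
rewrite (nth_map 0%N) ?size_iota // nth_iota //.
by rewrite (eqP (h _ _)) // mem_iota; lia.
Qed.

(** The differences telescope, starting from 0 because positive letters make [restrict 0 w]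
    empty. *)
Lemma CDTP m (delta w : seq nat) : size delta = m -> all (fun x => 0 < x)%N w ->
  (CDT m w == [seq d%:Z | d <- delta]) =
  all (fun l => cdes (restrict l w) == psum delta l) (iota 1 m).
Proof.
move=> <- wpos.
have sz : size (CDT (size delta) w) = size delta.
  by rewrite size_map size_iota.
have E l : (l < size delta)%N ->
    (nth 0 (CDT (size delta) w) l == nth 0 [seq d%:Z | d <- delta] l) =
    (cdes (restrict l.+1 w) == cdes (restrict l w) + part delta l.+1)%N.
  move=> hl; rewrite (nth_map 0%N) ?size_iota // nth_iota // add1n /=.
  by rewrite (nth_map 0%N) // subr_eq addrC -PoszD eqz_nat.
apply/eqP/allP => [h|h].
  have H l : (l <= size delta)%N -> cdes (restrict l w) = psum delta l.
    elim: l => [|l IH] hl; first by rewrite restrict0 // cdes_nil /psum take0.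
    by move: (E l hl); rewrite h eqxx psumS -IH ?(ltnW hl) // => /esym/eqP.
  by move=> l; rewrite mem_iota => hl; apply/eqP/H; lia.
have H l : (l <= size delta)%N -> cdes (restrict l w) = psum delta l.
  case: l => [|l] hl; first by rewrite restrict0 // cdes_nil /psum take0.
  by apply/eqP/h; rewrite mem_iota; lia.
apply: (@eq_from_nth _ 0); rewrite sz ?size_map // => l hl; apply/eqP.
by rewrite E // !H ?psumS // ltnW.
Qed.

Lemma letters_inj m n : injective (@letters m n).
Proof.
move=> w w' h; apply/val_inj; apply: inj_map h.
by move=> i j [] /val_inj.
Qed.

Definition wlist (alpha delta : seq nat) : seq (seq nat) :=
  [seq letters w | w <- enum (words alpha delta)].

Lemma wlist_uniq alpha delta : uniq (wlist alpha delta).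
Proof. by rewrite map_inj_uniq ?enum_uniq //; apply: letters_inj. Qed.

Lemma letters_bound m n (w : n.-tuple 'I_m) :
  all (fun x => 0 < x <= m)%N (letters w).
Proof. by apply/allP => x /mapP[i _ ->]; rewrite /= ltn_ord. Qed.

Lemma mem_wlist alpha delta u : (0 < size alpha)%N -> size delta = size alpha ->
  (u \in wlist alpha delta) =
  (size u == sumn alpha) && has_type alpha delta (size alpha) u.
Proof.
move=> h0 hs; apply/mapP/andP => [[w]|[/eqP su]].
  rewrite mem_enum inE contentP => /andP[h1 h2] ->.
  rewrite size_map size_tuple eqxx /has_type h1 -CDTP ?h2 ?letters_bound //.
  by apply: sub_all (letters_bound w) => x /andP[].
rewrite /has_type; case/and3P => [h1 h2 h3].
(* [f] inverts the encoding of letters; the default [Ordinal h0] is never reached, by the bound on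
   the letters of [u]. *)
pose f x : 'I_(size alpha) := insubd (Ordinal h0) x.-1.
have sz : size (map f u) == sumn alpha by rewrite size_map su.
have E : letters (Tuple sz) = u.
  rewrite /letters /= -map_comp -[RHS]map_id; apply/eq_in_map => x xu /=.
  have /andP[x1 x2] := allP h1 x xu.
  by rewrite val_insubd; case: ifP => //; lia.
exists (Tuple sz); last by [].
rewrite mem_enum inE E contentP h2 CDTP //.
by apply: sub_all h1 => x /andP[].
Qed.

Lemma has_type_rot alpha delta m i w :
  has_type alpha delta m w -> has_type alpha delta m (rot i w).
Proof.
have Pr : perm_eq (rot i w) w by rewrite perm_rot.
case/and3P=> h1 h2 h3; apply/and3P; split.
- by rewrite (perm_all _ Pr).
- by apply: sub_all h2 => l; rewrite (permP Pr).
apply: sub_all h3 => l; rewrite /restrict.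
(* Restricting a rotation gives a rotation of the restriction, by the number of letters kept in the
   prefix that was moved. *)
suff -> : [seq x <- rot i w | x <= l]%N =
  rot (size [seq x <- take i w | x <= l]%N) [seq x <- w | x <= l]%N.
  by rewrite cdes_rot.
rewrite [rot i w]/rot; have := cat_take_drop i w.
by move: (take i w) (drop i w) => a b <-; rewrite !filter_cat rot_size_cat.
Qed.

(** Rotation is injective and preserves the type, so it permutes the finite set of words. *)
Lemma wlist_rot alpha delta i : (0 < size alpha)%N -> size delta = size alpha ->
  perm_eq [seq rot i w | w <- wlist alpha delta] (wlist alpha delta).
Proof.
move=> h0 hs; have hi : injective (@rot nat i) := @rot_inj _ _.
have U : uniq [seq rot i w | w <- wlist alpha delta].
  by rewrite map_inj_uniq ?wlist_uniq.
apply: (uniq_perm U (wlist_uniq _ _)).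
have sub : {subset [seq rot i w | w <- wlist alpha delta] <= wlist alpha delta}.
  move=> _ /mapP[w + ->]; rewrite !mem_wlist // size_rot => /andP[->].
  exact: has_type_rot.
by case: (uniq_min_size U sub _); rewrite ?size_map.
Qed.

(* [head1_words l] lists the words on the letters 1, ..., l + 1 that begin with 1 and
   have the prescribed content and cyclic descent type. *)
Fixpoint head1_words (alpha delta : seq nat) (l : nat) : seq (seq nat) :=
  if l is l'.+1 then
    [seq u <- [seq u | v <- head1_words alpha delta l',
                       u <- insertions l.+1 (part alpha l.+1) v]
       | ldes 1 u == psum delta l.+1]
  else [:: nseq (part alpha 1) 1%N].

Section HeadOne.
Variables (alpha delta : seq nat).
Hypothesis alpha1 : (0 < part alpha 1)%N.
Hypothesis delta1 : part delta 1 = 0%N.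

Lemma cdes_head1 u : head 0%N u = 1%N -> cdes u = ldes 1 u.
Proof. by case: u => //= x u ->; rewrite cdes_ldes. Qed.

Lemma ldes_const t a : ldes t (nseq a t) = 0%N.
Proof. by elim: a => //= a ->; case: a => /=; rewrite ltnn. Qed.

Lemma lmaj_const t a : lmaj t (nseq a t) = 0%N.
Proof. by elim: a => //= a ->; rewrite ldes_const. Qed.

(** Deleting the largest letter leaves all smaller counts and restrictions unchanged. The right side
    is arranged to match [mem_insertions] and the filter in [head1_words]. *)
Lemma has_typeS m u : (0 < m)%N ->
  (head 0%N u == 1%N) && has_type alpha delta m.+1 u =
  [&& (head m.+2 u != m.+1) && (count_mem m.+1 u == part alpha m.+1),
      (head 0%N [seq x <- u | x != m.+1] == 1%N) &&
      has_type alpha delta m [seq x <- u | x != m.+1] &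
      ldes 1 u == psum delta m.+1].
Proof.
move=> m0; set u' := filter _ u.
have hh : (head 0%N u == 1%N) = (head m.+2 u != m.+1) && (head 0%N u' == 1%N).
  rewrite /u'; case: u {u'} => [|x u] /=; first by rewrite andbF.
  case: (x =P m.+1) => [->|] //=; lia.
rewrite hh; case: (boolP (head _ u != _)) => //= h1.
case: (boolP (head _ u' == _)) => /= h2; last by rewrite andbF.
have {}hh : head 0%N u = 1%N by apply/eqP; rewrite hh h1 h2.
have iotaS : iota 1 m.+1 = rcons (iota 1 m) m.+1.
  by have := iotaD 1 m 1; rewrite addn1 cats1 add1n.
rewrite /has_type iotaS !all_rcons.
have -> : all (fun x => 0 < x <= m)%N u' = all (fun x => 0 < x <= m.+1)%N u.
  rewrite /u' all_filter; apply: eq_all => x /=.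
  by case: eqP => /= [->|]; lia.
have -> : all (fun l => count_mem l u' == part alpha l) (iota 1 m) =
          all (fun l => count_mem l u == part alpha l) (iota 1 m).
  apply: eq_in_all => l; rewrite mem_iota => hl; congr (_ == _).
  rewrite /u' count_filter; apply: eq_count => x /=.
  by case: (x =P l) => //= ->; lia.
have -> : all (fun l => cdes (restrict l u') == psum delta l) (iota 1 m) =
          all (fun l => cdes (restrict l u) == psum delta l) (iota 1 m).
  apply: eq_in_all => l; rewrite mem_iota => hl; congr (cdes _ == _).
  rewrite /u' /restrict -filter_predI; apply: eq_filter => x /=.
  by lia.
case: (boolP (all _ u)) => [hu|]; last by rewrite andbF.
rewrite restrict_id // cdes_head1 //.
rewrite !andTb -!andbA; congr (_ && (_ && _)).
by rewrite andbC.
Qed.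

Lemma has_type_gtn m v : has_type alpha delta m v -> all (gtn m.+1) v.
Proof. by case/and3P => h _ _; apply: sub_all h => x /andP[]. Qed.

Lemma gtn_predC1 m v : all (gtn m) v -> all (predC1 m) v.
Proof. by apply: sub_all => x /=; rewrite ltn_neqAle => /andP[]. Qed.

Lemma mem_head1_words l u :
  (u \in head1_words alpha delta l) =
  (head 0%N u == 1%N) && has_type alpha delta l.+1 u.
Proof.
elim: l u => [|l IH] u.
  have psum1 : psum delta 1 = 0%N by rewrite psumS delta1 /psum take0.
  rewrite /= inE; apply/eqP/idP => [->|].
    rewrite /has_type /= psum1 !andbT count_nseq /= mul1n eqxx.
    rewrite (_ : head 0%N (nseq _ _) = 1%N); last by case: (part _ _) alpha1.
    rewrite restrict_id; last by rewrite all_nseq orbT.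
    rewrite all_nseq orbT cdes_head1 ?ldes_const //.
    by case: (part _ _) alpha1.
  case/andP => _ /and3P[h1 /= /andP[/eqP h2 _] _].
  have /all_pred1P E : all (pred1 1%N) u by apply: sub_all h1 => x /=; lia.
  by rewrite -h2 {1}E; congr nseq; apply/esym/eqP; rewrite -all_count E all_nseq orbT.
rewrite has_typeS // -IH mem_filter andbC andbA; congr (_ && _).
apply/allpairsPdep/idP => [[v [x [hv hx ->]]]|].
  have hC : all (predC1 l.+2) v.
    by apply/gtn_predC1/has_type_gtn; move: hv; rewrite IH => /andP[].
  by move: hx; rewrite mem_insertions // => /and3P[-> -> /eqP->].
case/andP => h1 h2; exists [seq x <- u | x != l.+2], u; split=> //.
have hC : all (predC1 l.+2) [seq x <- u | x != l.+2] by apply: filter_all.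
by rewrite mem_insertions // andbA h1 eqxx.
Qed.

Lemma head1_words_gtn l v : v \in head1_words alpha delta l -> all (gtn l.+2) v.
Proof. by rewrite mem_head1_words => /andP[_ /has_type_gtn]. Qed.

Lemma head1_words_uniq l : uniq (head1_words alpha delta l).
Proof.
elim: l => [|l IH] //=; apply/filter_uniq/allpairs_uniq_dep => //.
  by move=> v /head1_words_gtn/gtn_predC1; apply: uniq_insertions.
move=> _ _ /allpairsPdep[v [u [hv hu ->]]] /allpairsPdep[v' [u' [hv' hu' ->]]] /=.
move/head1_words_gtn/gtn_predC1: hv => hv; move/head1_words_gtn/gtn_predC1: hv' => hv'.
move: hu hu'; rewrite !mem_insertions // => /and3P[_ _ /eqP <-] /and3P[_ _ /eqP <-].
by move->.
Qed.

Lemma head1_words_ldes l v :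
  v \in head1_words alpha delta l -> ldes 1 v = psum delta l.+1.
Proof.
case: l => [|l] /=; last by rewrite mem_filter => /andP[/eqP].
by rewrite inE => /eqP->; rewrite ldes_const psumS delta1 /psum take0.
Qed.

Lemma head1_words_size l v :
  v \in head1_words alpha delta l -> size v = psum alpha l.+1.
Proof.
elim: l v => [|l IH] u.
  by rewrite inE psumS /psum take0 => /eqP->; rewrite size_nseq.
rewrite mem_filter => /andP[_ /allpairsPdep[v [x [hv hx ->]]]].
move: hx; rewrite mem_insertions; last exact/gtn_predC1/head1_words_gtn.
case/and3P => _ /eqP h1 /eqP h2.
rewrite psumS -(IH _ hv) -h1 -h2 size_filter addnC.
by rewrite -[in LHS](count_predC (pred1 l.+2)).
Qed.

Lemma head1_words_gf (R : comNzRingType) (z : R) l :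
  \sum_(u <- head1_words alpha delta l) z ^+ lmaj 1 u =
  \prod_(2 <= j < l.+2)
    (if (psum delta j.-1 <= psum alpha j.-1)%N then
       z ^+ (psum delta j * part delta j) *
       gauss z (psum alpha j.-1 - psum delta j.-1) (part delta j) *
       hsub z (psum delta j) (part alpha j) (part delta j)
     else 0).
Proof.
elim: l => [|l IH].
  by rewrite big_cons !big_nil lmaj_const addr0.
rewrite big_nat_recr //= -IH mulr_suml big_filter big_mkcond big_allpairs_dep.
apply: eq_big_seq => v hv; rewrite -big_mkcond.
have hK := head1_words_ldes hv; have hN := head1_words_size hv.
(* The word [v] itself shows that its descents do not outnumber its letters, so the conditional
   takes its first branch; without such a [v] both sums are empty. *)
rewrite -hK -hN ldes_size psumS -hK insertions_gf ?head1_words_gtn //.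
by rewrite exprD !mulrA.
Qed.
End HeadOne.

(** * Gaussian binomials and complete homogeneous polynomials *)

Section QBinomial.
Variables (F : fieldType) (x : F).

Lemma qfactS a : qfact x a.+1 = qfact x a * \sum_(0 <= j < a.+1) x ^+ j.
Proof. by rewrite /qfact big_nat_recr. Qed.

Lemma gauss_small n k : (n < k)%N -> gauss x n k = 0.
Proof.
elim: n k => [|n IH] [|k] //= h.
by rewrite !IH ?mulr0 ?addr0 //; lia.
Qed.

(** The induction step combines the q-Pascal rule with the splitting of the q-integer [[a + b]] as
    [[a] + x^a [b]]. *)
Lemma gauss_qfact k m :
  gauss x (k + m) k * (qfact x k * qfact x m) = qfact x (k + m).
Proof.
have qfact0 : qfact x 0 = 1 by rewrite /qfact big_nil.
elim: k m => [|k IHk] m; first by rewrite gauss0 qfact0 !mul1r.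
elim: m => [|m IHm].
  rewrite addn0 /= gauss_small // mulr0 add0r !qfactS qfact0 mulr1 mulrA.
  by have := IHk 0; rewrite addn0 qfact0 mulr1 => ->.
have -> : (k.+1 + m.+1)%N = (k + m.+1).+1 by lia.
rewrite [gauss _ _ _]/= mulrDl [in RHS]qfactS.
have -> : x ^+ k.+1 * gauss x (k + m.+1) k.+1 * (qfact x k.+1 * qfact x m.+1) =
  qfact x (k + m.+1) * (x ^+ k.+1 * \sum_(0 <= j < m.+1) x ^+ j).
  have -> : (k + m.+1 = k.+1 + m)%N by lia.
  by rewrite [qfact x m.+1]qfactS -IHm; ring.
have -> : gauss x (k + m.+1) k * (qfact x k.+1 * qfact x m.+1) =
  qfact x (k + m.+1) * \sum_(0 <= j < k.+1) x ^+ j.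
  by rewrite [qfact x k.+1]qfactS -IHk; ring.
rewrite -mulrDr; congr (_ * _).
have -> : (k + m.+1).+1 = (k.+1 + m.+1)%N by lia.
rewrite [RHS](@big_cat_nat _ _ _ k.+1) //=; last lia.
rewrite addrC; congr (_ + _).
rewrite -{2}[k.+1]add0n big_addn addKn mulr_sumr.
by apply: eq_bigr => i _; rewrite -exprD addnC.
Qed.

Hypothesis qint_neq0 : forall i, (0 < i)%N -> \sum_(0 <= j < i) x ^+ j != 0.

Lemma qfact_neq0 a : qfact x a != 0.
Proof.
elim: a => [|a IH]; first by rewrite /qfact big_nil oner_neq0.
by rewrite qfactS mulf_neq0 // qint_neq0.
Qed.

Lemma qbinomE (a b k : nat) :
  qbinom x (a%:Z - b%:Z) k%:Z = if (b <= a)%N then gauss x (a - b) k else 0.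
Proof.
rewrite /qbinom; case: (leqP b a) => hba; last first.
  by rewrite (_ : (_ && _) = false) //; lia.
rewrite subzn // lez_nat /=; case: leqP => hk; last by rewrite gauss_small.
rewrite subzn //= -[X in qfact x X / _](subnKC hk) -gauss_qfact (subnKC hk).
by rewrite mulfK // mulf_neq0 ?qfact_neq0.
Qed.
End QBinomial.

Section CompleteHomogeneous.
Variable R : comNzRingType.

Lemma complete_hom0 N (x : 'I_N -> R) : complete_hom 0 x = 1.
Proof.
rewrite /complete_hom (big_pred1 [tuple]) ?big_nil // => t.
by rewrite (tuple0 t); apply/esym/eqP.
Qed.

Lemma complete_hom_noX j (x : 'I_0 -> R) : complete_hom j.+1 x = 0.
Proof. by rewrite /complete_hom big1 // => t; case: (thead t). Qed.

(** A weakly increasing index sequence either begins with [ord0], which is stripped, or avoids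
    [ord0] altogether and can be shifted down. *)
Lemma complete_homS N j (x : 'I_N.+1 -> R) :
  complete_hom j.+1 x =
  x ord0 * complete_hom j x + complete_hom j.+1 (x \o lift ord0).
Proof.
rewrite {1}/complete_hom (bigID (fun t : _.-tuple _ => thead t == ord0)) /=.
congr (_ + _).
  rewrite (reindex_onto (fun t : j.-tuple _ => [tuple of ord0 :: t])
                        (fun t => [tuple of behead t])) /=; last first.
    move=> t /andP[_ /eqP ht]; rewrite [in RHS](tuple_eta t) ht.
    by apply/val_inj.
  rewrite /complete_hom mulr_sumr; apply: eq_big => [t|t _]; last first.
    by rewrite big_cons.
  rewrite theadE eqxx andbT (_ : (_ == t)); last by apply/eqP/val_inj.
  rewrite andbT path_min_sorted //.
  by apply/allP.
case: N x => [|N] x.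
  rewrite complete_hom_noX big1 // => t.
  by rewrite (ord1 (thead t)) andbF.
(* [h'] inverts [lift ord0] away from [ord0]; its default value needs an inhabited codomain, hence
   the separate case of one variable. *)
pose h' (i : 'I_N.+2) : 'I_N.+1 := odflt ord0 (unlift ord0 i).
have h'K i : i != ord0 -> lift ord0 (h' i) = i.
  by rewrite eq_sym => /unlift_some[k -> E]; rewrite /h' E.
rewrite (reindex_onto (fun t : j.+1.-tuple _ => [tuple of map (lift ord0) t])
                      (fun t => [tuple of map h' t])) /=; last first.
  move=> t /andP[hs h0]; apply/val_inj => /=; rewrite -map_comp -[RHS]map_id.
  apply/eq_in_map => i it /=; apply: h'K.
  move: hs it h0; rewrite {1 2}(tuple_eta t) /= (path_sortedE leq_trans).
  case/andP=> /allP hall _; rewrite inE => /predU1P[-> //|it].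
  have := hall i (map_f val it); rewrite -!val_eqE /=; lia.
rewrite /complete_hom; apply: eq_big => [t|t _]; last by rewrite big_map.
rewrite (_ : (_ == t)); last first.
  apply/eqP/val_inj; rewrite /= -map_comp -[RHS]map_id; apply: eq_map => i /=.
  by rewrite /h' liftK.
rewrite andbT (_ : thead _ != ord0) ?andbT; last first.
  by rewrite /thead tnth_map eq_sym neq_lift.
by rewrite -map_comp !sorted_map.
Qed.

Lemma complete_homZ N j c (x : 'I_N -> R) :
  complete_hom j (fun i => c * x i) = c ^+ j * complete_hom j x.
Proof.
rewrite /complete_hom mulr_sumr; apply: eq_bigr => t _.
by rewrite big_split /= big_tuple prodr_const card_ord.
Qed.

Lemma complete_hom_rev N j (x : 'I_N -> R) :
  complete_hom j (x \o @rev_ord N) = complete_hom j x.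
Proof.
pose h (t : j.-tuple 'I_N) := [tuple of rev (map (@rev_ord N) t)].
have hK : involutive h.
  move=> t; apply/val_inj; rewrite /= map_rev revK -map_comp -[RHS]map_id.
  by apply: eq_map => i /=; rewrite rev_ordK.
rewrite [RHS](reindex_inj (inv_inj hK)); apply: eq_big => [t|t _]; last first.
  by rewrite big_rev /= big_map.
rewrite /= map_rev -map_comp rev_sorted !sorted_map; apply: eq_sorted => i k /=.
by have := ltn_ord i; have := ltn_ord k; lia.
Qed.

Lemma eq_complete_hom N j (x y : 'I_N -> R) : x =1 y ->
  complete_hom j x = complete_hom j y.
Proof. by move=> E; apply: eq_bigr => t _; apply: eq_bigr => i _. Qed.
End CompleteHomogeneous.

Section MultichooseInverse.
Variables (F : fieldType) (x : F).
Hypothesis x0 : x != 0.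

Lemma hq0 e : hq x e 0 = 1.
Proof. by elim: e => //= e IH; rewrite big_ord1 muln0 expr0 mul1r IH. Qed.

(** Taking [x^e] out of each of the variables [x^e, ..., x] leaves [1, x^-1, ..., x^-(e-1)]; this is
    the source of the inverse of [q] in the first product. *)
Lemma hq_complete_hom e j :
  hq x e j = x ^+ (e * j) * complete_hom j (fun i : 'I_e => x^-1 ^+ i).
Proof.
elim: e j => [|e IHe] j.
  by case: j => [|j]; rewrite ?complete_hom0 ?complete_hom_noX ?mulr0 ?mulr1.
elim: j => [|j IHj]; first by rewrite hq0 complete_hom0 muln0 mulr1.
rewrite hqS IHj IHe complete_homS expr0 mul1r mulrDr addrC; congr (_ + _).
  by rewrite mulrA -exprD mulnS.
have /eq_complete_hom -> : (fun i : 'I_e.+1 => x^-1 ^+ i) \o lift ord0 =1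
    (fun i => x^-1 * x^-1 ^+ i) by move=> i; rewrite /= -exprS.
rewrite complete_homZ mulrA exprVn mulSn addnC exprD.
by rewrite mulfK // expf_neq0.
Qed.

(** Reversing the variables replaces [x^i] by [x^(e-i)], which is [x^e] times [x^-i]; homogeneity
    extracts the power. *)
Lemma complete_hom_inv e j :
  complete_hom j (fun i : 'I_e.+1 => x ^+ i) =
  x ^+ (e * j) * complete_hom j (fun i : 'I_e.+1 => x^-1 ^+ i).
Proof.
rewrite exprM -complete_homZ -complete_hom_rev; apply: eq_complete_hom => i /=.
have hi : (i <= e)%N by rewrite -ltnS.
have -> : x ^+ e = x ^+ (e - i) * x ^+ i by rewrite -exprD subnK.
by rewrite subSS exprVn mulfK // expf_neq0.
Qed.
End MultichooseInverse.

(** * Congruences of Laurent polynomials *)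

Lemma q_neq0 : q != 0.
Proof. by rewrite tofrac_eq0 polyX_eq0. Qed.

Lemma tofrac_neq0_horner (p : {poly rat}) a : p.[a] != 0 -> tofrac p != 0.
Proof.
by apply: contraNneq => /eqP; rewrite tofrac_eq0 => /eqP->; rewrite horner0.
Qed.

Lemma qint_neq0 i : (0 < i)%N -> \sum_(0 <= j < i) q ^+ j != 0.
Proof.
case: i => // i _.
have -> : \sum_(0 <= j < i.+1) q ^+ j = tofrac (\sum_(0 <= j < i.+1) 'X^j).
  by rewrite rmorph_sum; apply: eq_bigr => j _; rewrite rmorphXn.
apply: (@tofrac_neq0_horner _ 0); rewrite horner_sum big_nat_recl // hornerXn.
rewrite big1 ?addr0 ?oner_neq0 // => j _.
by rewrite hornerXn expr0n.
Qed.

Lemma natr_Qq_neq0 a : (0 < a)%N -> (a%:R : Qq) != 0.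
Proof.
move=> a0; rewrite -(rmorph_nat (@tofrac {poly rat})) tofrac_eq0.
by rewrite -polyC_natr polyC_eq0 Num.Theory.pnatr_eq0 -lt0n.
Qed.

Lemma qX_sub1_neq0 d : (0 < d)%N -> q ^+ d - 1 != 0.
Proof.
move=> d0; rewrite subrX1 mulf_neq0 //; last first.
  by have := qint_neq0 d0; rewrite big_mkord.
rewrite -(rmorph1 (@tofrac {poly rat})) -rmorphB.
by apply: (@tofrac_neq0_horner _ 0); rewrite !hornerE oppr_eq0 oner_neq0.
Qed.

Lemma addf_pow_div (F : fieldType) (a b x : F) N M : x != 0 ->
  a * x ^- N + b * x ^- M = (a * x ^+ M + b * x ^+ N) * x ^- (N + M).
Proof. by move=> x0; rewrite exprD; field; rewrite !expf_neq0. Qed.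

Lemma laurent_tofrac p : laurent (tofrac p).
Proof. by exists p, 0; rewrite expr0 invr1 mulr1. Qed.

Lemma laurentM x y : laurent x -> laurent y -> laurent (x * y).
Proof.
move=> [p [N ->]] [p' [N' ->]]; exists (p * p'), (N + N')%N.
by rewrite rmorphM exprD invfM; ring.
Qed.

Lemma laurentD x y : laurent x -> laurent y -> laurent (x + y).
Proof.
move=> [p [N ->]] [p' [N' ->]]; exists (p * 'X^N' + p' * 'X^N), (N + N')%N.
by rewrite rmorphD !rmorphM !rmorphXn addf_pow_div ?q_neq0.
Qed.

Lemma laurent1 : laurent 1.
Proof. by rewrite -(rmorph1 (@tofrac {poly rat})); apply: laurent_tofrac. Qed.

Lemma laurent0 : laurent 0.
Proof. by rewrite -(rmorph0 (@tofrac {poly rat})); apply: laurent_tofrac. Qed.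

Lemma laurentN x : laurent x -> laurent (- x).
Proof.
move=> [p [N ->]]; exists (- p), N.
by rewrite rmorphN mulNr.
Qed.

Lemma laurent_sum I (r : seq I) (P : pred I) (f : I -> Qq) :
  (forall i, P i -> laurent (f i)) -> laurent (\sum_(i <- r | P i) f i).
Proof. by apply: big_ind; [apply: laurent0|apply: laurentD]. Qed.

Lemma laurent_prod I (r : seq I) (P : pred I) (f : I -> Qq) :
  (forall i, P i -> laurent (f i)) -> laurent (\prod_(i <- r | P i) f i).
Proof. by apply: big_ind; [apply: laurent1|apply: laurentM]. Qed.

Lemma laurentX x a : laurent x -> laurent (x ^+ a).
Proof.
move=> hx; elim: a => [|a IH]; first by rewrite expr0; apply: laurent1.
by rewrite exprS; apply: laurentM.
Qed.

Lemma laurent_q : laurent q. Proof. exact: laurent_tofrac. Qed.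

Lemma laurent_qV : laurent q^-1.
Proof. by exists 1, 1%N; rewrite rmorph1 mul1r. Qed.

Lemma laurent_qz (e : int) : laurent (q ^ e).
Proof.
case: e => a; first exact/laurentX/laurent_q.
by rewrite NegzE -exprnN -exprVn; apply/laurentX/laurent_qV.
Qed.

Lemma laurent_natdiv a b : laurent (a%:R / b%:R).
Proof.
rewrite (_ : _ / _ = tofrac (a%:R / b%:R)%:P); first exact: laurent_tofrac.
case: b => [|b].
  by rewrite !mulr0n !invr0 !mulr0 rmorph0.
have hb : (b.+1%:R : rat) != 0 by rewrite Num.Theory.pnatr_eq0.
apply: (canLR (mulfK (natr_Qq_neq0 (ltn0Sn b)))).
rewrite -!(rmorph_nat (@tofrac {poly rat})) -rmorphM; congr tofrac.
by rewrite -!polyC_natr -polyCM divfK.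
Qed.

Lemma laurent_gauss a b : laurent (gauss q a b).
Proof.
elim: a b => [|a IH] [|b] /=; try exact: laurent1; first exact: laurent0.
by apply/laurentD/IH/laurentM/IH/(laurentX b.+1)/laurent_q.
Qed.

Lemma laurent_complete_hom N j (x : 'I_N -> Qq) :
  (forall i, laurent (x i)) -> laurent (complete_hom j x).
Proof. by move=> h; apply: laurent_sum => t _; apply: laurent_prod. Qed.

Lemma laurent_qmultichoose x N j : laurent x -> laurent (qmultichoose x N j).
Proof.
case: j => j h; last exact: laurent0.
by apply: laurent_complete_hom => i; apply: laurentX.
Qed.

Lemma laurent_qbinom (a b k : nat) : laurent (qbinom q (a%:Z - b%:Z) k%:Z).
Proof.
rewrite qbinomE; last exact: qint_neq0.
by case: ifP => _; [apply: laurent_gauss|apply: laurent0].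
Qed.

Section Congruence.
Variable n : nat.

Definition qcong (x y : Qq) : Prop :=
  exists2 z, laurent z & x - y = (q ^+ n - 1) * z.

Lemma qcong_refl x : qcong x x.
Proof. by exists 0; [apply: laurent0|rewrite subrr mulr0]. Qed.

Lemma qcong_trans y x z : qcong x y -> qcong y z -> qcong x z.
Proof.
move=> [u hu E] [v hv E']; exists (u + v); first exact: laurentD.
by rewrite mulrDr -E -E'; ring.
Qed.

Lemma qcong_sym x y : qcong x y -> qcong y x.
Proof.
move=> [u hu E]; exists (- u); first exact: laurentN.
by rewrite mulrN -E opprB.
Qed.

Lemma qcongD x y x' y' : qcong x y -> qcong x' y' -> qcong (x + x') (y + y').
Proof.
move=> [u hu E] [v hv E']; exists (u + v); first exact: laurentD.
by rewrite mulrDr -E -E'; ring.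
Qed.

Lemma qcongM c x y : laurent c -> qcong x y -> qcong (c * x) (c * y).
Proof.
move=> hc [u hu E]; exists (c * u); first exact: laurentM.
by rewrite -mulrBr E mulrCA.
Qed.

Lemma qcong_sum I (r : seq I) (P : pred I) (f g : I -> Qq) :
  (forall i, P i -> qcong (f i) (g i)) ->
  qcong (\sum_(i <- r | P i) f i) (\sum_(i <- r | P i) g i).
Proof.
by move=> h; apply: (big_ind2 qcong) => //; [apply: qcong_refl|apply: qcongD].
Qed.

Lemma qcongX a b : a = b %[mod n] -> qcong (q ^+ a) (q ^+ b).
Proof.
have H c : qcong (q ^+ c) (q ^+ (c %% n)).
  (* The cofactor is the geometric sum of [(q^n)^(c / n) - 1] over [q^n - 1]. *)
  exists (q ^+ (c %% n) * \sum_(i < c %/ n) (q ^+ n) ^+ i).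
    apply/laurentM; first exact/laurentX/laurent_q.
    by apply: laurent_sum => i _; do 2 apply: laurentX; apply: laurent_q.
  rewrite mulrCA -subrX1 mulrBr mulr1 -exprM -exprD mulnC addnC.
  by rewrite -divn_eq.
by move=> E; apply: (qcong_trans (H a)); rewrite E; apply/qcong_sym/H.
Qed.

End Congruence.

(** * Summing the shift factors over all rotations *)

Lemma sum_ord_mod (V : zmodType) d n' (g : nat -> V) :
  \sum_(i < d * n') g (i %% n')%N = (\sum_(b < n') g b) *+ d.
Proof.
elim: d => [|d IH]; first by rewrite big_ord0.
rewrite mulSn big_split_ord /= mulrS -IH; congr (_ + _).
  by apply: eq_bigr => i _; rewrite modn_small.
by apply: eq_bigr => i _; rewrite modnDl.
Qed.

(** Multiplication by [k'] is injective modulo [n'], so the arguments of [g] are permuted. *)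
Lemma sum_ord_affine (V : zmodType) n' k' (g : nat -> V) : coprime n' k' ->
  \sum_(b < n') g ((b.+1 * k') %% n')%N = \sum_(b < n') g b.
Proof.
case: n' => [|n'] hc; first by rewrite !big_ord0.
pose h (b : 'I_n'.+1) : 'I_n'.+1 := inZp (b.+1 * k')%N.
rewrite [RHS](reindex_inj (h := h)) // => b b' /(congr1 val) /= /eqP.
wlog le : b b' / (b <= b')%N.
  by move=> H; case: (leqP b b') => [/H|/ltnW/H H' /eqP/esym/eqP/H' ->].
rewrite eq_sym eqn_mod_dvd; last by rewrite leq_mul2r ltnS le orbT.
rewrite -mulnBl Gauss_dvdl // subSS => hd; apply/val_inj/eqP.
rewrite eqn_leq le /= -subn_eq0; apply: contraLR hd; rewrite -lt0n => hp.
by rewrite gtnNdvd //; have := ltn_ord b'; lia.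
Qed.

(** Modulo [n], the exponents run through the multiples of the gcd [d], each hit [d] times, which
    leaves [d] copies of a geometric sum in [q^d]. *)
Lemma sum_qX_shift n k : (0 < n)%N ->
  qcong n (\sum_(i < n) q ^+ (i.+1 * k))
    ((gcdn n k)%:R * ((q ^+ n - 1) / (q ^+ gcdn n k - 1))).
Proof.
move=> n0; set d := gcdn n k.
have d0 : (0 < d)%N by rewrite gcdn_gt0 n0.
pose n' := (n %/ d)%N; pose k' := (k %/ d)%N.
have En : n = (d * n')%N by rewrite mulnC divnK // dvdn_gcdl.
have Ek : k = (d * k')%N by rewrite mulnC divnK // dvdn_gcdr.
have hc : coprime n' k'.
  rewrite /coprime -(eqn_pmul2l d0) muln1 muln_gcdr -En -Ek //.
have -> : (q ^+ n - 1) / (q ^+ d - 1) = \sum_(b < n') (q ^+ d) ^+ b.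
  rewrite {1}En exprM subrX1 mulrC mulKf //; exact: qX_sub1_neq0.
rewrite mulr_natl -(sum_ord_affine _ hc).
rewrite -(sum_ord_mod d n' (fun b => (q ^+ d) ^+ ((b.+1 * k') %% n'))).
rewrite -En; apply: qcong_sum => i _; rewrite -exprM; apply: qcongX.
have -> : ((i %% n').+1 * k' = i.+1 * k' %[mod n'])%N.
  by rewrite -modnMml -addn1 modnDml addn1 modnMml.
by rewrite muln_modr -En modn_mod {1}Ek mulnCA.
Qed.

(** * The two product formulas *)

Lemma bin2D a b : 'C(a + b, 2) = ('C(a, 2) + 'C(b, 2) + a * b)%N.
Proof.
elim: b => [|b IH]; first by rewrite addn0 muln0 bin0n !addn0.
by rewrite addnS !binS !bin1 IH; lia.
Qed.

Lemma sqr_bin2 b : (b * b = 2 * 'C(b, 2) + b)%N.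
Proof. by elim: b => [|b IH] //; rewrite binS bin1; lia. Qed.

(** With [k_l = k_(l-1) + delta_l], the product [k_l delta_l] equals [C(k_l,2) - C(k_(l-1),2) +
    C(delta_l,2) + delta_l]. The first difference telescopes and the last term cancels. *)
Lemma prod_qz (alpha delta : seq nat) M : part delta 1 = 0%N ->
  \prod_(2 <= l < M.+2)
    q ^ ((part alpha l)%:Z - (part delta l)%:Z
         + (psum delta l * part delta l)%N%:Z) =
  q ^ ((psum alpha M.+1)%:Z - (part alpha 1)%:Z +
       ('C(psum delta M.+1, 2) + \sum_(2 <= l < M.+2) 'C(part delta l, 2))%N%:Z).
Proof.
move=> delta1; have p1 a : psum a 1 = part a 1 by rewrite psumS /psum take0.
elim: M => [|M IH].
  by rewrite !big_nil !p1 delta1 subrr expr0z.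
rewrite big_nat_recr //= IH -expfzDr ?q_neq0 // [in RHS]big_nat_recr //.
congr (q ^ _); rewrite (psumS alpha M.+1) (psumS delta M.+1) bin2D mulnDl sqr_bin2 /=.
rewrite !PoszD; lia.
Qed.

Lemma qmultichoose_inv N (j : int) : (N = 0 -> j != 0)%N ->
  qmultichoose q N j = q ^ (N%:Z * j - j) * qmultichoose q^-1 N j.
Proof.
case: j => j h; last by rewrite /= mulr0.
case: N h => [|N] h /=.
  by case: j h => [/(_ erefl)//|j] _; rewrite !complete_hom_noX mulr0.
rewrite complete_hom_inv ?q_neq0 //; congr (_ * _).
by rewrite [LHS]exprnP PoszM -addn1 PoszD; congr (q ^ _); ring.
Qed.

Lemma factor_eq (alpha delta : seq nat) l :
  (0 < part alpha l)%N -> (part delta l <= psum delta l)%N ->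
  q ^+ (psum delta l * part alpha l) *
    qbinom q ((psum alpha l.-1)%:Z - (psum delta l.-1)%:Z) (part delta l)%:Z *
    qmultichoose q^-1 (psum delta l) ((part alpha l)%:Z - (part delta l)%:Z) =
  q ^ ((part alpha l)%:Z - (part delta l)%:Z
       + (psum delta l * part delta l)%N%:Z) *
  (qbinom q ((psum alpha l.-1)%:Z - (psum delta l.-1)%:Z) (part delta l)%:Z *
   qmultichoose q (psum delta l) ((part alpha l)%:Z - (part delta l)%:Z)).
Proof.
(* If [k_l = 0] then [delta_l = 0], so the index [alpha_l - delta_l] is positive. *)
move=> a0 dl; rewrite [in RHS]qmultichoose_inv; last by move=> h; lia.
set X := qbinom _ _ _; set Y := qmultichoose q^-1 _ _.
rewrite [X * _]mulrCA [RHS]mulrA -expfzDr ?q_neq0 // -mulrA; congr (_ * _).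
by rewrite [LHS]exprnP !PoszM; congr (q ^ _); ring.
Qed.

Lemma factor_gf (alpha delta : seq nat) l :
  (if (psum delta l.-1 <= psum alpha l.-1)%N then
     q ^+ (psum delta l * part delta l) *
     gauss q (psum alpha l.-1 - psum delta l.-1) (part delta l) *
     hsub q (psum delta l) (part alpha l) (part delta l)
   else 0) =
  q ^+ (psum delta l * part alpha l) *
    qbinom q ((psum alpha l.-1)%:Z - (psum delta l.-1)%:Z) (part delta l)%:Z *
    qmultichoose q^-1 (psum delta l) ((part alpha l)%:Z - (part delta l)%:Z).
Proof.
rewrite qbinomE; last exact: qint_neq0.
case: ifP => _; last by rewrite mulr0 mul0r.
rewrite /hsub; case: leqP => h; last first.
  (* The index is negative here, so both sides vanish; [Negz p] stands for [-(p + 1)], hence the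
     predecessor. *)
  have -> : ((part alpha l)%:Z - (part delta l)%:Z)%R =
      Negz (part delta l - part alpha l).-1 by rewrite NegzE; lia.
  by rewrite /= !mulr0.
rewrite subzn // hq_complete_hom ?q_neq0 // mulrACA -exprD -mulrA.
rewrite -mulnDr subnKC // mulrA; congr (_ * _).
Qed.

(** Pairs of a word and a position holding 1 are counted in two ways: each word has [alpha_1] such
    positions, and for a fixed position [i] rotation by [i] turns these words into those beginning
    with 1. *)
Lemma words_maj_rot n k alpha delta :
  (0 < n)%N -> n = sumn alpha -> k = sumn delta -> size delta = size alpha ->
  (0 < part alpha 1)%N -> part delta 1 = 0%N ->
  qcong n ((part alpha 1)%:R * words_maj q alpha delta)
    ((\sum_(i < n) q ^+ (i.+1 * k)) *
     \sum_(u <- head1_words alpha delta (size alpha).-1) q ^+ lmaj 1 u).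
Proof.
move=> n0 En Ek hs a1 d1.
have m0 : (0 < size alpha)%N by case: (alpha) a1.
pose L := wlist alpha delta.
have LP u : u \in L ->
    [/\ size u = n, has_type alpha delta (size alpha) u & cdes u = k].
  rewrite mem_wlist // -En => /andP[/eqP su hu]; split=> //.
  case/and3P: hu => h1 _ /allP/(_ (size alpha)).
  rewrite restrict_id // mem_iota => /(_ _)/eqP -> //; last lia.
  by rewrite -hs psum_size.
have -> : words_maj q alpha delta = \sum_(u <- L) q ^+ maj u.
  by rewrite /L /wlist big_map big_enum.
have -> : (part alpha 1)%:R * \sum_(u <- L) q ^+ maj u =
    \sum_(i < n) \sum_(u <- L | nth 0%N u i == 1%N) q ^+ maj u.
  under [RHS]eq_bigr => i _ do rewrite big_mkcond.
  rewrite [RHS]exchange_big mulr_sumr; apply: eq_big_seq => u /LP[su hu _].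
  rewrite -big_mkcond sumr_const mulr_natl; congr (_ *+ _).
  have /allP/(_ 1%N) : all (fun l => count_mem l u == part alpha l)
    (iota 1 (size alpha)) by case/and3P: hu.
  rewrite mem_iota => /(_ _)/eqP <-; last lia.
  rewrite -sum1_count (big_nth 0%N) su big_mkord sum1_card.
  by apply: eq_card => i.
rewrite mulr_suml; apply: qcong_sum => i _.
have -> : \sum_(u <- head1_words alpha delta (size alpha).-1) q ^+ lmaj 1 u =
    \sum_(u <- L | nth 0%N (rot i u) 0 == 1%N) q ^+ cmaj (rot i u).
  transitivity (\sum_(u <- L | nth 0%N u 0 == 1%N) q ^+ cmaj u).
    have P : perm_eq (head1_words alpha delta (size alpha).-1)
        [seq u <- L | nth 0%N u 0 == 1%N].
      apply: uniq_perm; rewrite ?head1_words_uniq ?filter_uniq ?wlist_uniq //.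
      move=> u; rewrite mem_head1_words // prednK // mem_filter nth0 mem_wlist //.
      case: eqP => // h /=; rewrite andb_idl // => hu.
      rewrite -psum_size -(prednK m0); apply/eqP/(head1_words_size a1 d1).
      by rewrite mem_head1_words // h prednK.
    rewrite (perm_big _ P) big_filter; apply: eq_bigr => u.
    by case: u => //= x u /eqP ->; rewrite cmaj_lmaj.
  by rewrite -(perm_big _ (wlist_rot i m0 hs)) big_map.
rewrite mulr_sumr big_seq_cond [X in qcong _ _ X]big_seq_cond.
have -> : \sum_(u <- L | (u \in L) && (nth 0%N (rot i u) 0 == 1%N))
     q ^+ (i.+1 * k) * q ^+ cmaj (rot i u) =
   \sum_(u <- L | (u \in L) && (nth 0%N u i == 1%N))
     q ^+ (i.+1 * k) * q ^+ cmaj (rot i u).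
  apply: eq_bigl => u; case hu: (u \in L) => //=.
  have [su _ _] := LP u hu.
  by rewrite nth_rot ?su ?addn0 ?modn_small // ltnW.
apply: qcong_sum => u /andP[/LP[su _ ku] _].
have hi : (i <= size u)%N by rewrite su ltnW.
have := maj_mod u; have := cmaj_rot hi; rewrite su ku => E1 E2.
(* Rotation accounts for [i * k], and passing from [cmaj] to [maj] for one more [k]. *)
rewrite -exprD; apply: qcongX; rewrite E2 -modnDml E1 modnDml.
by congr (_ %% _)%N; rewrite mulSn; lia.
Qed.

Theorem theorem5p19 (n k : nat) (alpha delta : seq nat)
    (hn : (1 <= n)%N)
    (halpha : strong_composition n alpha)
    (hdelta : weak_composition k delta)
    (hsize : size delta = size alpha)
    (hdelta1 : part delta 1 = 0%N) :
  let m := size alpha in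
  let d := gcdn n k in
  let A := words_maj q alpha delta in
  let B :=
    d%:R / (part alpha 1)%:R * ((q ^+ n - 1) / (q ^+ d - 1)) *
    \prod_(2 <= l < m.+1)
      (q ^+ (psum delta l * part alpha l) *
       qbinom q ((psum alpha l.-1)%:Z - (psum delta l.-1)%:Z)
                (part delta l)%:Z *
       qmultichoose q^-1 (psum delta l)
                    ((part alpha l)%:Z - (part delta l)%:Z)) in
  let C :=
    d%:R / (part alpha 1)%:R * ((q ^+ n - 1) / (q ^+ d - 1)) *
    q ^ (('C(k, 2) + \sum_(2 <= l < m.+1) 'C(part delta l, 2))%N%:Z
         - (part alpha 1)%:Z) *
    \prod_(2 <= l < m.+1)
      (qbinom q ((psum alpha l.-1)%:Z - (psum delta l.-1)%:Z)
                (part delta l)%:Z *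
       qmultichoose q (psum delta l)
                    ((part alpha l)%:Z - (part delta l)%:Z)) in
  laurent_congr n A B /\ laurent_congr n B C.
Proof.
move=> m d A B C.
case/andP: halpha => hpos /eqP En; move/eqP: hdelta => Ek.
have m0 : (0 < m)%N by rewrite /m; case: (alpha) En hn => //= <-.
have pos l : (0 < l <= m)%N -> (0 < part alpha l)%N.
  by move=> hl; apply: (allP hpos); rewrite mem_nth // -/m; lia.
have a1 : (0 < part alpha 1)%N by apply: pos; rewrite m0.
have d0 : (0 < d)%N by rewrite gcdn_gt0 hn.
have dl l : (0 < l)%N -> (part delta l <= psum delta l)%N.
  by case: l => // l _; rewrite psumS leq_addl.
have hQ : laurent ((q ^+ n - 1) / (q ^+ d - 1)).
  rewrite -(divnK (dvdn_gcdl n k)) -/d mulnC exprM subrX1 mulrC.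
  rewrite mulKf ?qX_sub1_neq0 //.
  by apply: laurent_sum => i _; do 2 apply: laurentX; apply: laurent_q.
have hC : laurent C.
  apply: laurentM; first apply: laurentM; first apply: laurentM.
  - exact: laurent_natdiv.
  - exact: hQ.
  - exact: laurent_qz.
  apply: laurent_prod => l _; apply: laurentM; first exact: laurent_qbinom.
  exact/laurent_qmultichoose/laurent_q.
have pn : psum alpha m = n by rewrite psum_size.
have pk : psum delta m = k by rewrite /m -hsize psum_size.
(* The two products differ exactly by [q^n], so [C] itself is the cofactor of [q^n - 1] in
   [B - C]. *)
have BC : B = q ^+ n * C.
  rewrite /B; under eq_big_nat => l hl.
    rewrite factor_eq ?pos ?dl //; [|lia|lia].
    over.
  rewrite big_split /= -[in index_iota 2 m.+1](prednK m0) prod_qz // !prednK //.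
  rewrite pn pk /C /=; set P := _ / _ * _; set X := ('C(k, 2) + _)%N.
  have -> : (n%:Z - (part alpha 1)%:Z + X%:Z = n%:Z + (X%:Z - (part alpha 1)%:Z))%R.
    by ring.
  rewrite expfzDr ?q_neq0 // -exprnP.
  have AC (R : comNzRingType) (a b c e : R) : a * (b * c * e) = b * (a * c * e).
    by ring.
  exact: AC.
have hB : laurent B.
  by rewrite BC; apply: laurentM hC; apply/laurentX/laurent_q.
split; last first.
  by split=> //; exists C => //; rewrite BC mulrBl mul1r.
split=> //.
  by apply: laurent_sum => w _; apply/laurentX/laurent_q.
have a1q := natr_Qq_neq0 a1.
have aV : laurent (part alpha 1)%:R^-1.
  by rewrite -[_^-1]mul1r; apply: (laurent_natdiv 1).
(* The constant [alpha_1] is a unit among Laurent polynomials over the rationals, so the congruence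
   may be divided by it. *)
have -> : A = (part alpha 1)%:R^-1 * ((part alpha 1)%:R * A) by rewrite mulKf.
set G := \sum_(u <- head1_words alpha delta m.-1) q ^+ lmaj 1 u.
have -> : B = (part alpha 1)%:R^-1 * (G * (d%:R * ((q ^+ n - 1) / (q ^+ d - 1)))).
  rewrite /B /G head1_words_gf // prednK // (eq_bigr _ (fun l _ => factor_gf alpha delta l)).
  have AC (F : fieldType) (a b c g : F) : a / b * c * g = b^-1 * (g * (a * c)).
    by ring.
  exact: AC.
apply: qcongM => //.
apply: (qcong_trans (words_maj_rot hn (esym En) (esym Ek) hsize a1 hdelta1)).
rewrite mulrC; apply: qcongM; last exact: sum_qX_shift.
by apply: laurent_sum => w _; apply/laurentX/laurent_q.
Qed.
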